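(* Let $\mathcal V$ be Baker's variety, i.e. the variety generated by the polynomial reducts of lattices in which the ternary operation $f(a,b,c)=a\wedge(b\vee c)$ is the only fundamental operation. Then every algebra in $\mathcal V$ satisfies $$\sigma\cap(\tau\circ\upsilon)\subseteq(\sigma\cap\tau)\circ(\sigma\cap\upsilon)\circ(\sigma\cap\tau)\circ(\sigma\cap\upsilon)$$ for all U-admissible relations $\sigma,\tau,\upsilon$.
   Context: A binary relation on an algebra $\mathbf A$ is admissible if it is compatible with all operations. A relation is U-admissible if it is the set-theoretical union of some nonempty set of reflexive and admissible relations on $\mathbf A$. $\circ$ is relational composition. *)

(* Defs.v *)
From mathcomp Require Import all_boot all_order.
From mathcomp Require Import boolp classical_sets.

Set Implicit Arguments.
Unset Strict Implicit.
Unset Printing Implicit Defensive.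

Local Open Scope classical_set_scope.

(* Algebras whose only fundamental operation is ternary. *)
Record algebra3 := Algebra3 {
  carrier :> Type;
  op3 : carrier -> carrier -> carrier -> carrier
}.

Definition is_hom (A B : algebra3) (h : A -> B) : Prop :=
  forall x y z : A, h (op3 x y z) = op3 (h x) (h y) (h z).

Definition prod_algebra (I : Type) (A : I -> algebra3) : algebra3 :=
  @Algebra3 (forall i, A i) (fun x y z i => op3 (x i) (y i) (z i)).

(* Classes of algebras are plain predicates: a class in [set algebra3] would
   force the carriers into a universe too small for [latticeType]. *)

Definition closed_under_H (V : algebra3 -> Prop) : Prop :=
  forall (A B : algebra3) (h : A -> B),
    is_hom h -> (forall b : B, exists a : A, h a = b) -> V A -> V B.

(* Subalgebras are taken up to isomorphism, as domains of embeddings. *)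
Definition closed_under_S (V : algebra3 -> Prop) : Prop :=
  forall (A B : algebra3) (h : A -> B),
    is_hom h -> injective h -> V B -> V A.

Definition closed_under_P (V : algebra3 -> Prop) : Prop :=
  forall (I : Type) (A : I -> algebra3),
    (forall i, V (A i)) -> V (prod_algebra A).

Definition is_variety (V : algebra3 -> Prop) : Prop :=
  [/\ closed_under_H V, closed_under_S V & closed_under_P V].

Definition generated_variety (K : algebra3 -> Prop) (A : algebra3) : Prop :=
  forall V : algebra3 -> Prop,
    is_variety V -> (forall B, K B -> V B) -> V A.

Definition lattice_reduct (d : Order.disp_t) (L : latticeType d) : algebra3 :=
  @Algebra3 L (fun a b c => (a `&` (b `|` c))%O).

Definition baker_variety : algebra3 -> Prop :=
  generated_variety
    (fun A => exists (d : Order.disp_t) (L : latticeType d),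
       A = lattice_reduct L).

Definition admissible (A : algebra3) (r : set (A * A)) : Prop :=
  forall x x' y y' z z' : A,
    r (x, x') -> r (y, y') -> r (z, z') -> r (op3 x y z, op3 x' y' z').

(* Relational composition in diagrammatic order: r is applied first.  The
   library's [\;] on [set (X * Y)] composes in the opposite order. *)
Definition rel_comp (T : Type) (r s : set (T * T)) : set (T * T) :=
  [set xz | exists2 y, r (xz.1, y) & s (y, xz.2)].

Notation "r ;; s" := (rel_comp r s) (at level 50, left associativity).

(* The family S of reflexive admissible relations need not be directed. *)
Definition U_admissible (A : algebra3) (r : set (A * A)) : Prop :=
  exists S : set (set (A * A)),
    [/\ S !=set0,
        forall s, S s -> (forall x : A, s (x, x)) /\ admissible s
      & r = \bigcup_(s in S) s].

(* Main.v *)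
Require Import Defs.
From mathcomp Require Import all_boot all_order.
From mathcomp Require Import boolp classical_sets.

(** Write [f x y z] for the basic operation, which in a lattice is
    [x /\ (y \/ z)].  A pair [(a, c)] of the left-hand side selects one member
    of each of the three unions, say [s], [t] and [u], with [a s c] and
    [a t b u c], so it suffices to treat three reflexive admissible relations.
    The chain from [a] to [c] is then, read in a lattice,

      [a],  [a /\ (b \/ c)],  [a /\ c],  [c /\ (a \/ b)],  [c].

    A step lies in [s], [t] or [u] as soon as its two ends are values of one
    term, the right end arising from the left one by replacing some arguments
    [a] by [c], [a] by [b], or [b] by [c] respectively.  The [t] and [u] steps
    come from the single operation [f]: for instance
    [a = f a a c] goes to [f a b c], and [f a b c] to [f a c c = a /\ c].  So do
    the outer [s] steps, [a = f a b a] to [f a b c] and [f c a b] to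
    [f c c b = c].  The two middle [s] steps use one more meet:
    [a /\ (b \/ c) /\ a] goes to [a /\ (b \/ c) /\ c = a /\ c], and
    [a /\ c = c /\ (a \/ b) /\ a] goes to [c /\ (a \/ b) /\ c].

    Only finitely many identities in [f] are involved, the fields of
    [baker_identities].  They hold in lattices
    ([lattice_reduct_identities]) and define a variety
    ([baker_identities_variety]), hence hold throughout Baker's variety;
    [baker_chain] is the argument above. *)

Import Order.LTheory.

Local Open Scope classical_set_scope.

(** Since [op3 x y y] is [x /\ y] in a lattice, the last four identities say
    that this derived meet is commutative, and that it evaluates as expected
    on [x /\ (y \/ z)] and each of [x], [y], [z]. *)
Record baker_identities (A : algebra3) : Prop := BakerIdentities {
  op3_absorb_l : forall x y : A, op3 x x y = x;
  op3_absorb_r : forall x y : A, op3 x y x = x;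
  op3_meetC : forall x y : A, op3 x y y = op3 y x x;
  op3_meet1 : forall x y z : A, op3 (op3 x y z) x x = op3 x y z;
  op3_meet2 : forall x y z : A, op3 (op3 x y z) y y = op3 x y y;
  op3_meet3 : forall x y z : A, op3 (op3 x y z) z z = op3 x z z
}.

Lemma baker_identities_variety : is_variety baker_identities.
Proof.
split.
- move=> A B h hh hsurj [i1 i2 i3 i4 i5 i6].
  split=> x y; have [x' <-] := hsurj x; have [y' <-] := hsurj y.
  + by rewrite -hh i1.
  + by rewrite -hh i2.
  + by rewrite -!hh i3.
  + by move=> z; have [z' <-] := hsurj z; rewrite -!hh i4.
  + by move=> z; have [z' <-] := hsurj z; rewrite -!hh i5.
  + by move=> z; have [z' <-] := hsurj z; rewrite -!hh i6.
- move=> A B h hh hinj [i1 i2 i3 i4 i5 i6].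
  by split=> *; apply: hinj; rewrite !hh.
- move=> I A hA; split=> *; apply: functional_extensionality_dep => i /=.
  + exact: (op3_absorb_l _ (hA i)).
  + exact: (op3_absorb_r _ (hA i)).
  + exact: (op3_meetC _ (hA i)).
  + exact: (op3_meet1 _ (hA i)).
  + exact: (op3_meet2 _ (hA i)).
  + exact: (op3_meet3 _ (hA i)).
Qed.

Lemma lattice_reduct_identities (d : Order.disp_t) (L : latticeType d) :
  baker_identities (lattice_reduct L).
Proof.
split=> /= [x y|x y|x y|x y z|x y z|x y z]; rewrite ?joinxx.
- exact: joinKI.
- exact: joinKIC.
- exact: meetC.
- by rewrite meetAC meetxx.
- by rewrite -meetA joinIKC.
- by rewrite -meetA joinIK.
Qed.

Lemma baker_variety_identities (A : algebra3) :
  baker_variety A -> baker_identities A.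
Proof.
apply; first exact: baker_identities_variety.
by move=> B [d [L ->]]; exact: lattice_reduct_identities.
Qed.

(** In the composite, parsed from the left, the intermediate elements are found
    last to first: [c /\ (a \/ b)], then [a /\ c], then [a /\ (b \/ c)]. *)
Lemma baker_chain (A : algebra3) (s t u : set (A * A)) :
  baker_identities A ->
  (forall x, s (x, x)) -> admissible s ->
  (forall x, t (x, x)) -> admissible t ->
  (forall x, u (x, x)) -> admissible u ->
  s `&` (t ;; u) `<=` (s `&` t) ;; (s `&` u) ;; (s `&` t) ;; (s `&` u).
Proof.
move=> [absl absr meetC meet1 meet2 meet3] rs ads rt adt ru adu.
move=> [a c] [/= sac [b /= tab ubc]].
exists (op3 c a b); [exists (op3 a c c); [exists (op3 a b c)|]|]; split => /=.
- by rewrite -{1}(absr a b); apply: ads.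
- by rewrite -{1}(absl a c); apply: adt.
- by rewrite -(meet1 a b c) -(meet3 a b c); apply: ads; rewrite ?meet1.
- exact: adu.
- by rewrite meetC -(meet2 c a b) -(meet1 c a b); apply: ads; rewrite ?meet1.
- by rewrite meetC; apply: adt.
- by rewrite -{2}(absl c b); apply: ads.
- by rewrite -{2}(absr c a); apply: adu.
Qed.

Lemma rel_comp_mono (T : Type) (r r' s s' : set (T * T)) :
  r `<=` r' -> s `<=` s' -> (r ;; s) `<=` (r' ;; s').
Proof. by move=> rr' ss' xz [y /rr' ? /ss' ?]; exists y. Qed.

Theorem proposition3p5 (A : algebra3) (hA : baker_variety A)
    (sigma tau upsilon : set (A * A))
    (hsigma : U_admissible sigma)
    (htau : U_admissible tau)
    (hupsilon : U_admissible upsilon) :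
  sigma `&` (tau ;; upsilon) `<=`
  (sigma `&` tau) ;; (sigma `&` upsilon) ;; (sigma `&` tau) ;;
    (sigma `&` upsilon).
Proof.
move: hsigma htau hupsilon => [S [_ hS ->]] [T [_ hT ->]] [U [_ hU ->]].
move=> [a c] [[s Ss sac] [b [t Tt tab] [u Uu ubc]]].
have [rs ads] := hS s Ss; have [rt adt] := hT t Tt; have [ru adu] := hU u Uu.
have chain : ((s `&` t) ;; (s `&` u) ;; (s `&` t) ;; (s `&` u)) (a, c).
  apply: (baker_chain _ _ _ _ (baker_variety_identities _ hA)) => //.
  by split => //; exists b.
have sS : s `<=` \bigcup_(r in S) r := bigcup_sup Ss.
have tT : t `<=` \bigcup_(r in T) r := bigcup_sup Tt.
have uU : u `<=` \bigcup_(r in U) r := bigcup_sup Uu.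
by move: (a, c) chain; do ![apply: rel_comp_mono]; apply: setISS.
Qed.
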